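(* Let $n$ be a positive integer and equip $\mathbb{Z}^n$ with the $d_1$ (Manhattan) metric. Then for each real $r \geq n^2(2n-1)$, the Rips complex $\mathrm{Rips}((\mathbb{Z}^n,d_1), r)$ is contractible.
   Context: The $d_1$ metric on $\mathbb{R}^n$ (restricted to $\mathbb{Z}^n$) is $d_1((a_1,\dots,a_n),(b_1,\dots,b_n)) = \sum_{i=1}^n |a_i-b_i|$. For a metric space $(X,d)$ and $r\ge 0$, the (closed) Rips complex $\mathrm{Rips}(X,r)$ is the abstract simplicial complex with vertex set $X$ in which a nonempty finite subset $\sigma\subseteq X$ is a simplex if and only if $\mathrm{Diam}(\sigma)=\max_{x,y\in\sigma} d(x,y)\le r$. Contractibility of an abstract simplicial complex means contractibility of its geometric realization. *)

(* Defs.v *)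
From HB Require Import structures.
From mathcomp Require Import all_boot all_order all_algebra finmap.
From mathcomp Require Import all_classical all_reals all_analysis.

Set Implicit Arguments.
Unset Strict Implicit.
Unset Printing Implicit Defensive.

Import Order.TTheory GRing.Theory Num.Theory.
Import numFieldNormedType.Exports.

Local Open Scope classical_set_scope.
Local Open Scope ring_scope.

Record simplicial_complex (V : choiceType) := SimplicialComplex {
  simplex : set {fset V};
  simplex_neq0 : forall s, simplex s -> s != fset0;
  simplex_sub : forall s t, simplex s -> (t `<=` s)%fset -> t != fset0 ->
    simplex t }.

Section Rips.
Variables (R : realType) (X : metricType R).

Definition diam (s : {fset X}) : R :=
  \big[Num.max/0]_(x <- s) \big[Num.max/0]_(y <- s) mdist x y.

Lemma diamP (s : {fset X}) (r : R) : 0 <= r ->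
  (diam s <= r) <-> (forall x y, x \in s -> y \in s -> mdist x y <= r).
Proof.
move=> r0; rewrite /diam; split.
  move=> sr x y xs ys; apply: le_trans sr.
  have dy := le_bigmax_seq 0 _ xpredT (mdist x) ys isT; apply: (le_trans dy).
  exact: (le_bigmax_seq 0 _ xpredT
    (fun z => \big[Num.max/0]_(y <- s) mdist z y) xs isT).
move=> H; rewrite big_seq; elim/big_ind: _ => // [a b ar br|x xs].
  by rewrite ge_max ar.
rewrite big_seq; elim/big_ind: _ => // [a b ar br|y ys]; last exact: H.
by rewrite ge_max ar.
Qed.

Lemma diam_ge0 (s : {fset X}) : 0 <= diam s.
Proof. exact: bigmax_ge_id. Qed.

Definition rips_simplex (r : R) : set {fset X} :=
  [set s | s != fset0 /\ diam s <= r].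

Lemma rips_simplex_neq0 r s : rips_simplex r s -> s != fset0.
Proof. by case. Qed.

Lemma rips_simplex_sub r s t : rips_simplex r s -> (t `<=` s)%fset ->
  t != fset0 -> rips_simplex r t.
Proof.
move=> [s0 sr] /fsubsetP ts t0; split=> //.
have r0 : 0 <= r := le_trans (diam_ge0 s) sr.
move/(diamP _ r0) : sr => sr; apply/(diamP _ r0) => x y xt yt.
by apply: sr; exact: ts.
Qed.

Definition rips (r : R) : simplicial_complex X :=
  SimplicialComplex (@rips_simplex_neq0 r) (@rips_simplex_sub r).

Lemma rips_vertex (r : R) (x : X) : 0 <= r -> simplex (rips r) [fset x]%fset.
Proof.
move=> r0; split; first by apply/fset0Pn; exists x; rewrite inE.
apply/(diamP _ r0) => y z; rewrite !inE => /eqP-> /eqP->.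
by rewrite mdistxx.
Qed.

End Rips.

Section Realization.
Variables (R : realType) (V : choiceType) (K : simplicial_complex V).

(* Points of the realization are given by their barycentric coordinates. *)
Definition barycentric : set {ptws V -> R} :=
  [set t | exists2 s : {fset V}, simplex K s &
    [/\ forall v, 0 <= t v, forall v, (v \in s) = (t v != 0)
      & \sum_(v <- s) t v = 1] ].

(* The points of closed_face s vanish outside the finite set s, so that the
   topology induced by pointwise convergence is the Euclidean one. *)
Definition closed_face (s : {fset V}) : set {ptws V -> R} :=
  barycentric `&` [set t | forall v, v \notin s -> t v = 0].

Definition face_incl (s : {fset V}) : closed_face s -> barycentric :=
  subfun (@subIsetl _ barycentric _).

(* The realization does not carry the topology of pointwise convergence but the
   coherent (weak) one, which is final for the inclusions of the faces. *)
Definition realization : Type := barycentric.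

HB.instance Definition _ := Choice.on realization.

Definition realization_open : set_system realization :=
  [set U | forall s, simplex K s -> open (@face_incl s @^-1` U)].

Let realization_openT : realization_open setT.
Proof. by move=> s _; rewrite preimage_setT; exact: openT. Qed.

Let realization_openI : setI_closed realization_open.
Proof.
by move=> A B oA oB s Ks; rewrite preimage_setI; apply: openI; [exact: oA|exact: oB].
Qed.

Let realization_open_bigU (I : Type) (f : I -> set realization) :
  (forall i, realization_open (f i)) -> realization_open (\bigcup_i f i).
Proof.
move=> oF s Ks; rewrite preimage_bigcup.
by apply: bigcup_open => i _; exact: oF.
Qed.

HB.instance Definition _ := isOpenTopological.Build realization
  realization_openT realization_openI realization_open_bigU.

End Realization.

Section Contractible.
Variable R : realType.

Definition homotopic (S T : topologicalType) (f g : S -> T) : Prop :=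
  exists H : S * R -> T,
    [/\ {within [set: S] `*` `[0, 1], continuous H},
        forall x, H (x, 0) = f x & forall x, H (x, 1) = g x].

Definition contractible (T : topologicalType) : Prop :=
  exists x0 : T, homotopic (@idfun T) (fun=> x0).

End Contractible.

Definition d1 (R : realType) (n : nat) (x y : 'rV[R]_n) : R :=
  \sum_(i < n) `|x ord0 i - y ord0 i|.

(* Z^n with the metric d1; R only serves as the type of the distances. *)
Definition lattice_d1 (R : realType) (n : nat) : Type := 'rV[int]_n.

Section LatticeMetric.
Variables (R : realType) (n : nat).

HB.instance Definition _ := Choice.on (lattice_d1 R n).

Definition lattice_dist (a b : lattice_d1 R n) : R :=
  d1 (map_mx intr a) (map_mx intr b).

Let lattice_distxx a : lattice_dist a a = 0.
Proof. by rewrite /lattice_dist /d1 big1// => i _; rewrite subrr normr0. Qed.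

Let lattice_dist_positivity a b : lattice_dist a b = 0 -> a = b.
Proof.
move=> /eqP; rewrite /lattice_dist /d1 psumr_eq0// => /allP ab.
apply/matrixP => i j; rewrite ord1.
have := ab j; rewrite mem_index_enum => /(_ isT) /=.
by rewrite normr_eq0 !mxE subr_eq0 eqr_int => /eqP.
Qed.

Let lattice_dist_sym a b : lattice_dist a b = lattice_dist b a.
Proof. by apply: eq_bigr => i _; rewrite distrC. Qed.

Let lattice_dist_triangle b a c :
  lattice_dist a c <= lattice_dist a b + lattice_dist b c.
Proof.
by rewrite /lattice_dist /d1 -big_split/=; apply: ler_sum => i _; exact: ler_distD.
Qed.

HB.instance Definition _ := isMetric.Build R (lattice_d1 R n)
  lattice_distxx lattice_dist_positivity lattice_dist_sym lattice_dist_triangle.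

End LatticeMetric.

(* Main.v *)
Require Import Defs.
From HB Require Import structures.
From mathcomp Require Import all_boot all_order all_algebra finmap.
From mathcomp Require Import all_classical all_reals all_analysis.
From mathcomp Require Import ring lra zify.

Set Implicit Arguments.
Unset Strict Implicit.
Unset Printing Implicit Defensive.

Import Order.TTheory GRing.Theory Num.Theory.
Import numFieldNormedType.Exports.

Local Open Scope classical_set_scope.
Local Open Scope ring_scope.

(** The contraction is written down in one formula; it goes through R^n, which
    is contractible, and works for every locally finite complex whose vertices
    sit in R^n in a suitable way ([contractible_by_centers]).

    A finite set of diameter at most [m] in [(R^n, d1)] lies in a ball of radius
    [rho := n / (n + 1) * m], with some center in R^n; this is Jung's theorem
    with Bohnenblust's constant, [jung_center].  So if [m] is large there is
    room around a center: when [t] is a simplex contained in the [rho]-ball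
    around [e], and [t'] consists of lattice points at distance less than [n]
    from [e], then [t] and [t'] together still span a simplex.  The interplay
    of constants is [2 * n <= m + 1] and [rho + n <= m + 1], the latter meaning
    [n ^ 2 - 1 <= m], and both follow from the bound on the scale.  The [m + 1]
    comes from the distances between lattice points being integers: smaller than
    [m + 1] is the same as at most [m], where [m] is the integer part of the
    scale.

    Let [x] be a point of the realization, with barycentric coordinates
    [bary v x].  There is a continuous positive [threshold] that some coordinate
    of [x] exceeds.  Average the centers of all simplices [s] which carry more
    than [1 - threshold x] of the mass of [x]: each of them contains every
    vertex whose coordinate reaches the threshold, so the average
    [center_map x] is within [rho] of all these vertices ([center_map_close]),
    and it depends continuously on [x].  The homotopy has three stages.
    - Lower all coordinates of [x] by a growing amount, up to the threshold,
      cutting off at 0 and normalizing; the support only shrinks.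
    - Trade what is left for a combination of the lattice points close to
      [center_map x]; the vertices left by the first stage are within [rho] of
      that point, so everything happens inside one simplex.
    - Shrink the point of R^n to the origin, always taking the combination of
      the lattice points close to it.

    A locally finite complex carries the topology of its coordinates
    ([to_realization_continuous]), so that the continuity of the homotopy is
    that of real-valued formulas and of locally finite sums of them. *)

(** * Center of a finite set in the Manhattan metric *)

Lemma cofactor_rowsub_update (F : comNzRingType) N m (L : 'M[F]_(N, m))
    (f g : 'I_m -> 'I_N) (j k : 'I_m) : (forall i, i != j -> f i = g i) ->
  cofactor (rowsub f L) j k = cofactor (rowsub g L) j k.
Proof.
move=> fg; rewrite /cofactor; congr (_ * \det _).
by apply/matrixP => a b; rewrite !mxE fg// eq_sym neq_lift.
Qed.

(** Among the submatrices made of [\rank A] rows, take one of maximal volume: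
    by Cramer's rule, a coordinate of another row in this basis is the ratio of
    two volumes, the denominator being the maximal one.  The volumes are those
    of the rows of [col_base A], the coordinates of the rows of [A] in a basis
    of its row space, which covers matrices that are not of full rank. *)
Lemma row_basis_bounded_coords (F : realFieldType) N k (A : 'M[F]_(N, k)) :
  exists f : 'I_(\rank A) -> 'I_N, forall i, exists2 l : 'rV_(\rank A),
    row i A = l *m rowsub f A & forall j, `|l ord0 j| <= 1.
Proof.
set L := col_base A; have Lfull : row_full L := col_base_full A.
pose vol (f : {ffun 'I_(\rank A) -> 'I_N}) := `|\det (rowsub f L)|.
pose f0 : {ffun 'I_(\rank A) -> 'I_N} := fullrankfun Lfull.
have vol0 : 0 < vol f0.
  by rewrite normr_gt0 -unitfE; exact: (fullrowsub_unit Lfull).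
pose f := [arg max_(f > f0) vol f]%O.
have fmax g : vol g <= vol f by rewrite /f; case: arg_maxP => // h _; exact.
have detf : \det (rowsub f L) != 0.
  by rewrite -normr_gt0; exact: lt_le_trans (fmax f0).
exists f => i; exists (row i L *m invmx (rowsub f L)).
  have -> : rowsub f A = rowsub f L *m row_base A.
    by rewrite mul_rowsub_mx mulmx_base.
  by rewrite mulmxA mulmxKV ?unitmxE ?unitfE// -row_mul mulmx_base.
move=> j; pose g := [ffun h => if h == j then i else f h].
suff -> : (row i L *m invmx (rowsub f L)) ord0 j =
    \det (rowsub g L) / \det (rowsub f L).
  by rewrite normrM normfV ler_pdivrMr ?normr_gt0// mul1r; exact: fmax.
rewrite /invmx unitmxE unitfE detf -scalemxAr mxE mulrC; congr (_ / _).
rewrite (expand_det_row _ j) mxE; apply: eq_bigr => h _.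
rewrite !mxE ffunE eqxx; congr (_ * _).
by apply: cofactor_rowsub_update => a aj; rewrite ffunE (negbTE aj).
Qed.

(** Adding a coordinate 1 to the points turns linear combinations into affine
    ones.  Choose points [v_j], [m] of them, of which every [a i] is an affine
    combination with coefficients [l_j <= 1].  The center is the barycenter of
    the [v_j]: as the vectors [l_j (v_j - a i)] sum to 0, its difference with
    [a i] is the sum of the [(1 - l_j) / m * (v_j - a i)], whose coefficients
    are nonnegative and sum to [(m - 1) / m], and [m <= n + 1]. *)
Lemma jung_center (R : realType) n N (a : 'I_N -> 'rV[R]_n) (M : R) :
  (forall i j, d1 (a i) (a j) <= M) ->
  exists c, forall i, d1 c (a i) <= n%:R / n.+1%:R * M.
Proof.
case: N a => [a _|N a aM]; first by exists 0 => -[].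
have M0 : 0 <= M by apply: le_trans (aM ord0 ord0); exact: sumr_ge0.
pose A : 'M[R]_(N.+1, n + 1) := \matrix_i row_mx (a i) 1.
have [f fP] := row_basis_bounded_coords A.
have rkA : (\rank A <= n.+1)%N.
  by have := rank_leq_col A; rewrite [X in (_ <= X)%N -> _]addn1.
move: (\rank A) rkA f fP => m mn f fP.
exists (m%:R^-1 *: \sum_j a (f j)) => i.
have [l lA l1] := fP i.
have ai : a i = \sum_j l ord0 j *: a (f j).
  have : lsubmx (row i A) = lsubmx (l *m rowsub f A) by rewrite lA.
  rewrite rowK row_mxKl => ->; apply/rowP => h; rewrite !mxE summxE.
  apply: eq_bigr => j _; rewrite !mxE; congr (_ * _).
  by rewrite (unsplitK (inl h)).
have sum1 : \sum_j l ord0 j = 1.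
  have : rsubmx (row i A) ord0 ord0 = rsubmx (l *m rowsub f A) ord0 ord0.
    by rewrite lA.
  rewrite rowK row_mxKr !mxE eqxx => one; apply/esym/(etrans one).
  by apply: eq_bigr => j _; rewrite !mxE (unsplitK (inr ord0))/= !mxE mulr1.
case: m mn f fP l lA l1 ai sum1 => [|m] mn f _ l _ l1 ai sum1.
  by move: sum1 => /esym/eqP; rewrite big_ord0 oner_eq0.
have m0 : (m.+1%:R : R) != 0 by rewrite pnatr_eq0.
have cE h : (m.+1%:R^-1 *: \sum_j a (f j)) ord0 h - a i ord0 h =
    \sum_j ((1 - l ord0 j) / m.+1%:R) * (a (f j) ord0 h - a i ord0 h).
  under [RHS]eq_bigr do rewrite mulrBr.
  rewrite sumrB -mulr_suml -mulr_suml sumrB sum1 big_const_ord iter_addr_0.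
  rewrite mxE summxE.
  have aih : a i ord0 h = \sum_j l ord0 j * a (f j) ord0 h.
    by rewrite ai summxE; apply: eq_bigr => j _; rewrite mxE.
  under [X in _ = X - _]eq_bigr do
    rewrite mulrAC mulrBl mul1r mulrBl.
  rewrite sumrB -!mulr_suml -aih.
  by rewrite mulrBl divff//; field.
rewrite /d1; under eq_bigr do rewrite cE.
apply: (@le_trans _ _ (\sum_j (1 - l ord0 j) / m.+1%:R * d1 (a (f j)) (a i))).
  rewrite /d1; under [leRHS]eq_bigr do rewrite mulr_sumr.
  rewrite exchange_big/=; apply: ler_sum => h _.
  apply: le_trans (ler_norm_sum _ _ _) _; apply: ler_sum => j _.
  rewrite normrM ger0_norm// divr_ge0// subr_ge0.
  exact: le_trans (ler_norm _) (l1 j).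
apply: (@le_trans _ _ (\sum_j (1 - l ord0 j) / m.+1%:R * M)).
  apply: ler_sum => j _; apply: ler_wpM2l => //.
  by rewrite divr_ge0// subr_ge0; exact: le_trans (ler_norm _) (l1 j).
rewrite -!mulr_suml sumrB sum1 big_const_ord iter_addr_0; apply: ler_wpM2r => //.
rewrite ler_pdivrMr ?ltr0Sn// mulrAC ler_pdivlMr ?ltr0Sn//.
move: mn; rewrite ltnS -(ler_nat R) -!natr1 => mn; lra.
Qed.


(** * Continuity of sums and positive parts *)

Lemma sum_continuous (R : realType) (S : topologicalType) (E : normedModType R)
    (I : Type) (s : seq I) (a : S -> I -> E) (x : S) :
  (forall i, {for x, continuous (a^~ i)}) ->
  {for x, continuous (fun y => \sum_(i <- s) a y i)}.
Proof.
move=> ca; suff : (fun y => \sum_(i <- s) a y i) @ x --> \sum_(i <- s) a x i by [].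
elim: s => [|i s IH].
  by rewrite big_nil; under eq_fun do rewrite big_nil; exact: cvg_cst.
rewrite big_cons; under eq_fun do rewrite big_cons.
by apply: cvgD => //; exact: ca.
Qed.

Section LocallyFiniteSum.
Context {R : realType} {S : topologicalType} {E : normedModType R} {I : choiceType}.

(** All the sums over infinite types below are of this kind: near each point
    they are sums over one and the same finite set. *)
Definition locally_finite_family (x : S) (a : S -> I -> E) :=
  exists W : {fset I}, \forall y \near x, forall i, i \notin W -> a y i = 0.

Lemma locally_finite_sum_continuous (x : S) (a : S -> I -> E) :
  locally_finite_family x a -> (forall i, {for x, continuous (a^~ i)}) ->
  {for x, continuous (fun y => \sum_(i \in [set: I]) a y i)}.
Proof.
move=> [W Wa] ca.
have aW : \forall y \near x, \sum_(i <- W) a y i = \sum_(i \in [set: I]) a y i.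
  by apply: filterS Wa => y Wa; rewrite (fsbigTE W).
have aWx := nbhs_singleton aW; rewrite /= in aWx.
have : (fun y => \sum_(i <- W) a y i) @ x --> \sum_(i <- W) a x i.
  exact: sum_continuous.
rewrite aWx; apply: cvg_trans; exact: near_eq_cvg.
Qed.
End LocallyFiniteSum.

Section PositivePart.
Context {R : realType}.

Definition pos_part (a : R) : R := Num.max a 0.

Lemma pos_part_continuous : continuous pos_part.
Proof.
by move=> a; apply: (@continuous_max _ R id (fun=> 0)); [exact: cvg_id|exact: cvg_cst].
Qed.

Lemma pos_part_ge0 a : 0 <= pos_part a.
Proof. by rewrite /pos_part le_max lexx orbT. Qed.

Lemma pos_part_eq0 a : (pos_part a == 0) = (a <= 0).
Proof. by rewrite /pos_part; case: leP => // a0; [rewrite eqxx|rewrite gt_eqF]. Qed.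

Lemma pos_part_gt0 a : (0 < pos_part a) = (0 < a).
Proof. by rewrite lt0r pos_part_eq0 pos_part_ge0 andbT ltNge. Qed.

Lemma pos_part_id a : 0 <= a -> pos_part a = a.
Proof. by move=> a0; rewrite /pos_part max_l. Qed.

Lemma pos_part_neg a : a <= 0 -> pos_part a = 0.
Proof. by move=> a0; rewrite /pos_part max_r. Qed.

Lemma cvg_pos_part (T : Type) (F : set_system T) {FF : Filter F} (f : T -> R) l :
  f y @[y --> F] --> l -> pos_part (f y) @[y --> F] --> pos_part l.
Proof. by move=> fl; apply: continuous_cvg => //; exact: pos_part_continuous. Qed.
End PositivePart.

(** * The Manhattan metric as a function on the space of rows *)

Section D1.
Context {R : realType} {n : nat}.
Implicit Types x y z : 'rV[R]_n.

Lemma d1C x y : d1 x y = d1 y x.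
Proof. by apply: eq_bigr => i _; rewrite distrC. Qed.

Lemma d1_triangle y x z : d1 x z <= d1 x y + d1 y z.
Proof. by rewrite /d1 -big_split/=; apply: ler_sum => i _; exact: ler_distD. Qed.

Lemma d1xx x : d1 x x = 0.
Proof. by rewrite /d1 big1// => i _; rewrite subrr normr0. Qed.

Lemma d1_continuous y : continuous (fun x : 'rV[R]_n => d1 x y).
Proof.
move=> x; apply: (@sum_continuous _ _ R _ _ (fun z i => `|z ord0 i - y ord0 i|)) => i.
exact: (cvg_norm (cvgB (@coord_continuous R 1 n ord0 i x)
  (cvg_cst (y ord0 i)))).
Qed.

(** Balls of [d1] are convex, stated for weights that need not sum to 1. *)
Lemma d1_average (I : Type) (s : seq I) (w : I -> R) (c : I -> 'rV[R]_n) x rho :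
  0 < \sum_(i <- s) w i -> (forall i, 0 <= w i) ->
  (forall i, w i != 0 -> d1 (c i) x <= rho) ->
  d1 ((\sum_(i <- s) w i)^-1 *: \sum_(i <- s) w i *: c i) x <= rho.
Proof.
set W := \sum_(i <- s) w i => W0 w0 crho.
have Wn0 : W != 0 by rewrite gt_eqF.
have coordE h : (W^-1 *: \sum_(i <- s) w i *: c i) ord0 h - x ord0 h =
    W^-1 * \sum_(i <- s) w i * (c i ord0 h - x ord0 h).
  rewrite mxE summxE; under eq_bigr do rewrite mxE.
  under [in RHS]eq_bigr do rewrite mulrBr.
  by rewrite sumrB -mulr_suml -/W mulrBr mulKf.
rewrite /d1; under eq_bigr do rewrite coordE normrM ger0_norm ?invr_ge0 ?(ltW W0)//.
rewrite -mulr_sumr mulrC ler_pdivrMr// mulrC mulr_suml.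
apply: (@le_trans _ _ (\sum_(i <- s) w i * d1 (c i) x)).
  rewrite /d1; under [leRHS]eq_bigr do rewrite mulr_sumr.
  rewrite exchange_big/=; apply: ler_sum => h _.
  apply: le_trans (ler_norm_sum _ _ _) _; apply: ler_sum => i _.
  by rewrite normrM (ger0_norm (w0 i)).
apply: ler_sum => i _; have [->|wi] := eqVneq (w i) 0; first by rewrite !mul0r.
by rewrite ler_wpM2l// crho.
Qed.
End D1.

(** * Continuous maps and the realization *)

Lemma cvg_ptws (S : Type) (V : choiceType) (T : topologicalType)
    (F : set_system S) (f : S -> V -> T) (g : V -> T) : Filter F ->
  (forall v, f y v @[y --> F] --> g v) ->
  (f y : {ptws V -> T}) @[y --> F] --> (g : {ptws V -> T}).
Proof.
move=> FF fg; apply/cvg_sup => v A [_ [[C oC <-] Cg CA]].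
have FC : F (fun y => C (f y v)) by apply: fg; exact: open_nbhs_nbhs.
suff : F [set y | A (f y)] by [].
by apply: filterS FC => y Cy; exact: CA.
Qed.

Definition locally_finite (V : choiceType) (K : simplicial_complex V) :=
  forall v, finite_set [set s | simplex K s /\ v \in s].

Definition star (V : choiceType) (K : simplicial_complex V) (v : V) :
    {fset {fset V}} :=
  fset_set [set s | simplex K s /\ v \in s].

Lemma in_star (V : choiceType) (K : simplicial_complex V) v s :
  locally_finite K -> s \in star K v <-> simplex K s /\ v \in s.
Proof. by move=> lfK; rewrite in_fset_set// inE. Qed.

Section RealizationTopology.
Context {R : realType} {V : choiceType} {K : simplicial_complex V}.
Local Notation X := (realization R K).

Definition bary (v : V) (x : X) : R := \val x v.

Lemma closed_face_val_continuous (s : {fset V}) :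
  continuous (fun x : closed_face (R := R) K s => \val x : {ptws V -> R}).
Proof. exact: initial_continuous. Qed.

Lemma realization_openE (U : set X) : open U = realization_open U.
Proof. by []. Qed.

Lemma bary_continuous (v : V) : continuous (bary v).
Proof.
apply/continuousP => A oA; rewrite realization_openE => s Ks.
have -> : @face_incl R V K s @^-1` (bary v @^-1` A) =
    (fun x : closed_face (R := R) K s => \val x : {ptws V -> R}) @^-1`
    ((fun x : {ptws V -> R} => x v) @^-1` A).
  by apply/seteqP; split => x; rewrite /preimage /bary /=.
apply: open_comp; first by move=> x _; exact: closed_face_val_continuous.
apply: open_comp => // x _; exact: (@proj_continuous _ (fun=> R) v).
Qed.

Lemma bary_simplex (x : X) : exists2 s : {fset V}, simplex K s &
  [/\ forall v, 0 <= bary v x, forall v, (v \in s) = (bary v x != 0)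
    & \sum_(v <- s) bary v x = 1].
Proof. by have := set_valP x. Qed.

Lemma bary_ge0 (x : X) v : 0 <= bary v x.
Proof. by have [s _ []] := bary_simplex x. Qed.

Lemma eq_bary (x y : X) : (forall v, bary v x = bary v y) -> x = y.
Proof. by move=> xy; apply: val_inj; apply/funext => v; exact: xy. Qed.

(** The realization of a locally finite complex has the topology of pointwise
    convergence of the coordinates.  If the coordinate at [u] of [h y0] is not
    zero, it stays so near [y0], where [h] thus takes its values in the faces of
    the finitely many simplices that contain [u].  For each of them, a
    neighborhood in the coherent topology restricts to a pointwise one on the
    face if [h y0] lies on that face; otherwise [h] avoids the face near [y0],
    as faces are closed. *)
Lemma to_realization_continuous (S : topologicalType) (h : S -> X) :
  locally_finite K -> (forall v, continuous (bary v \o h)) -> continuous h.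
Proof.
move=> lfK ch y0 O; rewrite nbhsE => -[B [+ By0] BO]; rewrite realization_openE => oB.
apply: filterS (_ : \forall y \near y0, B (h y)) => [y|]; first exact: BO.
have ch_near v : \forall y \near y0, bary v (h y0) != 0 -> bary v (h y) != 0.
  have [_|hv] := eqVneq (bary v (h y0)) 0; first by near=> y.
  by apply: filterS (cvgr_neq0 _ (ch v y0) hv).
have [s0 Ks0 [_ s0E _]] := bary_simplex (h y0).
have [u us0] := fset0Pn _ (simplex_neq0 Ks0).
have local s : simplex K s -> \forall y \near y0,
    (forall v, v \notin s -> bary v (h y) = 0) -> B (h y).
  move=> Ks.
  have [hs|/existsNP[v /not_implyP[vs /eqP hv]]] :=
      pselect (forall v, v \notin s -> bary v (h y0) = 0); last first.
    apply: filterS (ch_near v) => y /(_ hv) yv /(_ v vs) yv0.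
    by rewrite yv0 eqxx in yv.
  have [A oA AB] := oB s Ks.
  have cval : (fun y => \val (h y) : {ptws V -> R}) @ y0 --> (\val (h y0) : {ptws V -> R}).
    by apply: cvg_ptws => v; exact: ch.
  have in_face y : (forall v, v \notin s -> bary v (h y) = 0) ->
      B (h y) <-> A (\val (h y)).
    move=> hy.
    have fy : closed_face (R := R) K s (\val (h y)).
      by split => //; exact: set_valP.
    have -> : h y = @face_incl R V K s (SigSub (mem_set fy)) by exact: val_inj.
    by rewrite -[B _]/((@face_incl R V K s @^-1` B) _) -AB.
  have : nbhs (\val (h y0) : {ptws V -> R}) A.
    by apply: open_nbhs_nbhs; split => //; exact/(in_face y0 hs).
  move=> /cval Acval; have {}Acval : \forall y \near y0, A (\val (h y)) by [].
  by apply: filterS Acval => y Ay hy; exact/(in_face y hy).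
have star_near : \forall y \near y0, forall s, s \in star K u ->
    (forall v, v \notin s -> bary v (h y) = 0) -> B (h y).
  by apply: (filter_bigI (D := star K u)) => s /in_star -/(_ lfK)[Ks _]; exact: local.
have us : bary u (h y0) != 0 by rewrite -s0E.
near=> y.
have uy : bary u (h y) != 0 by apply: (near (ch_near u) y).
have [s Ks [_ sE _]] := bary_simplex (h y).
have ss : s \in star K u by apply/in_star => //; split=> //; rewrite sE.
apply: (near star_near y _ s ss) => //.
by move=> v; rewrite sE negbK => /eqP.
Unshelve. all: by end_near.
Qed.
End RealizationTopology.

(** * Selecting the large coordinates of a point *)

Section LargeCoordinates.
Context {R : realType} {V : choiceType} {K : simplicial_complex V}.
Local Notation X := (realization R K).

Lemma bary_sum (x : X) : \sum_(v \in [set: V]) bary v x = 1.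
Proof.
have [s _ [_ sE <-]] := bary_simplex x.
by apply: fsbigTE => v; rewrite sE negbK => /eqP.
Qed.

Lemma bary_sum_le1 (t : {fset V}) (x : X) : \sum_(v <- t) bary v x <= 1.
Proof.
have [s _ [ge0 sE <-]] := bary_simplex x.
rewrite [leRHS](big_fset_incl _ (fsubsetUr t s)); last first.
  by move=> v _; rewrite sE negbK => /eqP.
rewrite [leRHS](big_fsetID _ (mem t)) /=.
have -> : [fset v in (t `|` s)%fset | v \in t]%fset = t.
  by apply/fsetP => v; rewrite !inE/= andb_idl// => ->.
by rewrite lerDl sumr_ge0.
Qed.

Lemma bary_neq0_near (x : X) (v : V) : bary v x != 0 ->
  \forall y \near x, bary v y != 0.
Proof. exact: (cvgr_neq0 _ (@bary_continuous _ _ _ v x)). Qed.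

Hypothesis lfK : locally_finite K.

Lemma bary_locally_finite (x : X) :
  locally_finite_family x (fun y v => bary v y).
Proof.
have [s Ks [_ sE _]] := bary_simplex x.
have [u us] := fset0Pn _ (simplex_neq0 Ks).
exists (\bigcup_(t <- star K u) t)%fset.
have : bary u x != 0 by rewrite -sE.
move=> /bary_neq0_near; apply: filterS => y uy v vW.
have [t Kt [_ tE _]] := bary_simplex y.
apply/eqP; apply: contraNT vW; rewrite -tE => vt.
by apply/bigfcupP; exists t; rewrite // andbT; apply/in_star => //; rewrite tE.
Qed.

(** Half the weighted mean of the coordinates, each weighted by itself: it lies
    below the largest coordinate, and unlike the latter it is a locally finite
    sum. *)
Definition threshold (x : X) : R := 2^-1 * \sum_(v \in [set: V]) bary v x ^+ 2.

Lemma threshold_gt0 x : 0 < threshold x.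
Proof.
have [s Ks [_ sE _]] := bary_simplex x.
have [u us] := fset0Pn _ (simplex_neq0 Ks).
rewrite /threshold mulr_gt0// (fsbigTE s); last first.
  by move=> v; rewrite sE negbK => /eqP->; rewrite expr0n.
rewrite (big_fsetD1 u us)/= ltr_wpDr//.
  by apply: sumr_ge0 => v _; exact: sqr_ge0.
by rewrite exprn_even_gt0//= -sE.
Qed.

Lemma threshold_lt x : exists v, threshold x < bary v x.
Proof.
apply: contrapT => /forallNP nlt.
have [s Ks [_ sE s1]] := bary_simplex x.
have : \sum_(v <- s) bary v x ^+ 2 <= threshold x.
  rewrite -[leRHS]mulr1 -s1 mulr_sumr; apply: ler_sum => v _.
  by rewrite expr2 ler_wpM2r ?bary_ge0// leNgt; apply/negP.
have := threshold_gt0 x.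
rewrite /threshold (fsbigTE s); last first.
  by move=> v; rewrite sE negbK => /eqP->; rewrite expr0n.
lra.
Qed.

Lemma threshold_continuous : continuous threshold.
Proof.
move=> x; suff c : {for x, continuous (fun y : X =>
    \sum_(v \in [set: V]) bary v y ^+ 2)}.
  exact: (cvgMl_tmp c).
apply: locally_finite_sum_continuous => [|v].
  have [W b] := bary_locally_finite x; exists W; apply: filterS b => y yW v /yW ->.
  by rewrite expr0n.
exact: (cvgM (@bary_continuous _ _ _ v x) (@bary_continuous _ _ _ v x)).
Qed.

(** Positive when the mass of [x] outside the simplex [s] is less than the
    threshold.  Such a simplex may have vertices at which [x] vanishes; what
    matters is that it misses no large coordinate. *)
Definition cover_weight (x : X) (s : {fset V}) : R :=
  if `[<simplex K s>] then pos_part (threshold x - 1 + \sum_(v <- s) bary v x)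
  else 0.

Lemma cover_weight_ge0 x s : 0 <= cover_weight x s.
Proof. by rewrite /cover_weight; case: ifP => // _; exact: pos_part_ge0. Qed.

Lemma cover_weight_simplex x s : cover_weight x s != 0 -> simplex K s.
Proof. by rewrite /cover_weight; case: asboolP => //; rewrite eqxx. Qed.

(** The mass of [x] outside [s] is at least its coordinate at any vertex that
    [s] misses. *)
Lemma cover_weight_mem x s v : cover_weight x s != 0 -> threshold x <= bary v x ->
  v \in s.
Proof.
move=> w0 tv; apply: contraNT w0 => vs.
rewrite /cover_weight; case: ifP => // _; rewrite pos_part_eq0.
have := bary_sum_le1 (v |` s)%fset x; rewrite big_fsetU1//=; lra.
Qed.

(** A vertex where [x] exceeds the threshold does so near [x], and belongs to
    every simplex of nonzero weight. *)
Lemma cover_weight_locally_finite x : locally_finite_family x cover_weight.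
Proof.
have [u ux] := threshold_lt x; exists (star K u).
have c : {for x, continuous (fun y => bary u y - threshold y)}.
  exact: (cvgB (@bary_continuous _ _ _ u x) (@threshold_continuous x)).
have : 0 < bary u x - threshold x by rewrite subr_gt0.
move=> /(cvgr_gt _ c); apply: filterS => y uy s; apply: contraNeq => w0.
apply/in_star => //; split; first exact: cover_weight_simplex w0.
by apply: cover_weight_mem w0 _; rewrite ltW// -subr_gt0.
Qed.

Lemma cover_weight_continuous s : continuous (cover_weight^~ s).
Proof.
move=> x; rewrite /cover_weight; case: (asboolP (simplex K s)) => _; last first.
  by apply: cst_continuous.
have c := @sum_continuous _ _ R _ s (fun y v => bary v y) x
  (fun v => @bary_continuous R V K v x).
exact: (cvg_pos_part (cvgD (cvgB (@threshold_continuous x) (cvg_cst (1 : R))) c)).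
Qed.

(** The simplex carrying [x] has all its mass, hence weight [threshold x]. *)
Lemma cover_weight_sum_gt0 x : 0 < \sum_(s \in [set: {fset V}]) cover_weight x s.
Proof.
have [W WE] := cover_weight_locally_finite x.
have {}WE := nbhs_singleton WE.
have [s Ks [_ sE s1]] := bary_simplex x.
have ws : 0 < cover_weight x s.
  rewrite /cover_weight asboolT// s1 pos_part_gt0.
  by have := threshold_gt0 x; lra.
rewrite (fsbigTE W)//.
have sW : s \in W by apply: contraLR ws => /WE ->; rewrite ltxx.
rewrite (big_fsetD1 s sW)/= ltr_wpDr//.
by apply: sumr_ge0 => t _; exact: cover_weight_ge0.
Qed.
End LargeCoordinates.

(** * Points of the realization from unnormalized coordinates *)

Definition simplicial_weights (R : realType) (V : choiceType)
    (K : simplicial_complex V) (u : V -> R) :=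
  (forall v, 0 <= u v) /\
  exists2 s : {fset V}, simplex K s & forall v, (v \in s) = (u v != 0).

Section Normalize.
Context {R : realType} {V : choiceType} {K : simplicial_complex V}.
Local Notation X := (realization R K).

Lemma simplicial_weights_sum_gt0 (u : V -> R) : simplicial_weights K u ->
  0 < \sum_(v \in [set: V]) u v.
Proof.
move=> [u0 [s Ks sE]]; rewrite (fsbigTE s); last first.
  by move=> v; rewrite sE negbK => /eqP.
have [v vs] := fset0Pn _ (simplex_neq0 Ks).
by rewrite (big_fsetD1 v vs)/= ltr_wpDr ?sumr_ge0// lt0r -sE vs u0.
Qed.

Lemma normalized_barycentric (u : V -> R) : simplicial_weights K u ->
  barycentric K (fun v => u v / \sum_(w \in [set: V]) u w).
Proof.
move=> uw; have sum0 := simplicial_weights_sum_gt0 uw.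
have [u0 [s Ks sE]] := uw.
exists s => //; split=> [v|v|].
- by rewrite divr_ge0// ltW.
- by rewrite mulf_eq0 invr_eq0 (gt_eqF sum0) orbF sE.
- rewrite -mulr_suml (fsbigTE s) ?divff//; last first.
    by move=> v; rewrite sE negbK => /eqP.
  move: sum0; rewrite (fsbigTE s) => [/gt_eqF -> //|].
  by move=> v; rewrite sE negbK => /eqP.
Qed.

Definition normalize (u : V -> R) (uw : simplicial_weights K u) : X :=
  SigSub (mem_set (normalized_barycentric uw)).

Lemma normalizeE (u : V -> R) (uw : simplicial_weights K u) v :
  bary v (normalize uw) = u v / \sum_(w \in [set: V]) u w.
Proof. by []. Qed.

Lemma normalize_continuous (S : topologicalType) (u : S -> V -> R)
    (uw : forall y, simplicial_weights K (u y)) :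
  locally_finite K -> (forall v, continuous (u^~ v)) ->
  (forall y, locally_finite_family y u) ->
  continuous (fun y => normalize (uw y)).
Proof.
move=> lfK cu lfu; apply: to_realization_continuous => // v y.
have c : {for y, continuous (fun z => \sum_(w \in [set: V]) u z w)}.
  by apply: locally_finite_sum_continuous => // w; exact: cu.
have sum0 := lt0r_neq0 (simplicial_weights_sum_gt0 (uw y)).
exact: (cvgM (cu v y) (cvgV sum0 c)).
Qed.
End Normalize.

(** * Contraction *)

Section CenterMap.
Context {R : realType} {V : choiceType} {K : simplicial_complex V} {n : nat}.
Local Notation X := (realization R K).
Context (p : V -> 'rV[R]_n) (rho : R) (c : {fset V} -> 'rV[R]_n).

(** The centers [c s] are arbitrary here; they are related to the vertices in
    [center_map_close] only. *)
Definition center_map (x : X) : 'rV[R]_n :=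
  (\sum_(s \in [set: {fset V}]) cover_weight x s)^-1 *:
  \sum_(s \in [set: {fset V}]) cover_weight x s *: c s.

Lemma center_map_continuous : locally_finite K -> continuous center_map.
Proof.
move=> lfK x.
have [W WE] := cover_weight_locally_finite lfK x.
have c1 : {for x, continuous (fun y : X =>
    \sum_(s \in [set: {fset V}]) cover_weight y s)}.
  apply: locally_finite_sum_continuous => [|s]; first by exists W.
  exact: cover_weight_continuous.
have c2 : {for x, continuous (fun y : X =>
    \sum_(s \in [set: {fset V}]) cover_weight y s *: c s)}.
  apply: locally_finite_sum_continuous => [|s].
    by exists W; apply: filterS WE => y yW s /yW ->; rewrite scale0r.
  exact: (cvgZ (@cover_weight_continuous _ _ _ lfK s x) (cvg_cst (c s))).
exact: (cvgZ (cvgV (lt0r_neq0 (cover_weight_sum_gt0 lfK x)) c1) c2).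
Qed.

(** The center map averages centers of simplices that all contain [v]. *)
Lemma center_map_close x v : locally_finite K ->
  (forall s, simplex K s -> forall v, v \in s -> d1 (c s) (p v) <= rho) ->
  threshold x <= bary v x -> d1 (center_map x) (p v) <= rho.
Proof.
move=> lfK cP xv; rewrite /center_map.
have sum0 := cover_weight_sum_gt0 lfK x.
have [W WE] := cover_weight_locally_finite lfK x.
have {}WE := nbhs_singleton WE.
move: sum0; rewrite !(fsbigTE W)//; last by move=> s /WE ->; rewrite scale0r.
move=> sum0; apply: d1_average => // [s|s ws]; first exact: cover_weight_ge0.
apply: cP; first exact: cover_weight_simplex ws.
exact: cover_weight_mem ws xv.
Qed.
End CenterMap.

Section Contraction.
Context {R : realType} {V : choiceType} {K : simplicial_complex V} {n : nat}.
Local Notation X := (realization R K).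
(** The vertices sit in R^n through [p]; [eps] is the size of the neighborhood
    of a point of R^n whose vertices represent that point in [K], and [rho] the
    radius of the balls around the centers [c s]. *)
Context (p : V -> 'rV[R]_n) (eps rho : R).
Hypothesis lfK : locally_finite K.
Hypothesis finite_ball : forall e M, finite_set [set v | d1 e (p v) < M].
Hypothesis net : forall e, exists v, d1 e (p v) < eps.
Hypothesis glue : forall e (s t : {fset V}), simplex K s -> t != fset0 ->
  (forall v, v \in t -> v \in s /\ d1 e (p v) <= rho \/ d1 e (p v) < eps) ->
  simplex K t.

Context (c : {fset V} -> 'rV[R]_n).
Hypothesis cP :
  forall s, simplex K s -> forall v, v \in s -> d1 (c s) (p v) <= rho.

(** The trace in R^n of the last two stages: the center map up to time 1/2,
    then a straight line to the origin, reached at time 1. *)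
Definition track (z : X * R) : 'rV[R]_n :=
  Num.min 1 (2 - 2 * z.2) *: center_map c z.1.

(** The coordinates that remain of the point [z.1] at time [z.2]; at time 1/4
    they are cut down by the threshold, and at time 1/2 nothing is left. *)
Definition leaving_weight (z : X * R) (v : V) : R :=
  pos_part (1 - 2 * z.2) *
  pos_part (bary v z.1 - pos_part (4 * z.2) * threshold z.1).

(** The vertices near the track, which come in at time 1/4. *)
Definition entering_weight (z : X * R) (v : V) : R :=
  pos_part (4 * z.2 - 1) * pos_part (eps - d1 (track z) (p v)).

Definition contraction_weight (z : X * R) (v : V) : R :=
  leaving_weight z v + entering_weight z v.

Lemma leaving_weight_neq0 x t v : leaving_weight (x, t) v != 0 ->
  t < 1 / 2 /\ pos_part (4 * t) * threshold x < bary v x.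
Proof.
rewrite mulf_eq0 negb_or !pos_part_eq0 -!ltNge !subr_gt0/= => /andP[h ->].
by split=> //; lra.
Qed.

Lemma entering_weight_neq0 x t v : entering_weight (x, t) v != 0 ->
  1 / 4 < t /\ d1 (track (x, t)) (p v) < eps.
Proof.
rewrite mulf_eq0 negb_or !pos_part_eq0 -!ltNge !subr_gt0/= => /andP[h ->].
by split=> //; lra.
Qed.

(** The support is a simplex at all times.  Up to time 1/4 it is contained in
    that of the given point [x].  Between the times 1/4 and 1/2 it consists of
    vertices with coordinate above the threshold and of vertices near
    [center_map x], and afterwards only of vertices near the track. *)
Lemma contraction_weight_simplicial z :
  simplicial_weights K (contraction_weight z).
Proof.
case: z => x t; split=> [v|]; first by rewrite addr_ge0// mulr_ge0// pos_part_ge0.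
set u := contraction_weight (x, t).
have [s Ks [_ sE _]] := bary_simplex x.
have thr0 := threshold_gt0 x.
have uN0 v : u v != 0 ->
    leaving_weight (x, t) v != 0 \/ entering_weight (x, t) v != 0.
  apply: contra_neqP => /not_orP[/negP + /negP]; rewrite !negbK => /eqP a /eqP b.
  by rewrite /u /contraction_weight a b addr0.
have leaving_s v : leaving_weight (x, t) v != 0 -> v \in s.
  move=> /leaving_weight_neq0[_ h]; rewrite sE gt_eqF//; apply: le_lt_trans h.
  by rewrite mulr_ge0 ?pos_part_ge0// ltW.
pose ball := fset_set [set v | d1 (track (x, t)) (p v) < eps].
pose supp := [fset v in (s `|` ball)%fset | u v != 0]%fset.
have suppE v : (v \in supp) = (u v != 0).
  rewrite !inE/= andb_idl// => /uN0[/leaving_s ->//|/entering_weight_neq0[_ h]].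
  by apply/orP; right; rewrite in_fset_set ?inE.
exists supp => //.
have [t4|t4] := leP t (1 / 4).
  have enter0 v : entering_weight (x, t) v = 0.
    by rewrite /entering_weight/= pos_part_neg ?mul0r//; lra.
  apply: (simplex_sub Ks).
    apply/fsubsetP => v; rewrite suppE => /uN0[/leaving_s//|].
    by rewrite enter0 eqxx.
  have [v xv] := threshold_lt x.
  apply/fset0Pn; exists v; rewrite suppE /u /contraction_weight enter0 addr0.
  rewrite mulf_neq0// lt0r_neq0// pos_part_gt0 ?subr_gt0/=; first lra.
  apply: le_lt_trans xv; rewrite ler_piMl ?(ltW thr0)//.
  by rewrite /pos_part ge_max ler01 andbT; lra.
apply: (glue (e := track (x, t)) Ks).
  have [v ev] := net (track (x, t)).
  apply/fset0Pn; exists v; rewrite suppE /u /contraction_weight.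
  rewrite gt_eqF// ltr_wpDl//; first by rewrite mulr_ge0 ?pos_part_ge0.
  by rewrite mulr_gt0 ?pos_part_gt0 ?subr_gt0//=; lra.
move=> v; rewrite suppE => /uN0[vl|/entering_weight_neq0[_ h]]; last by right.
left; split; first exact: leaving_s.
have [t2 h] := leaving_weight_neq0 vl.
rewrite /track/= min_l ?scale1r; last by lra.
apply: (center_map_close lfK cP); apply/ltW/(le_lt_trans _ h).
rewrite ler_peMl ?(ltW thr0)//.
by rewrite /pos_part le_max; apply/orP; left; lra.
Qed.

Definition contraction (z : X * R) : X :=
  normalize (contraction_weight_simplicial z).

Lemma track_continuous : continuous track.
Proof.
move=> z.
have fst_at : {for z, continuous (fst : X * R -> X)} by exact: cvg_fst.
have ct : {for z, continuous (fun z : X * R => z.2)} by exact: cvg_snd.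
have cF : {for z, continuous (fun z : X * R => center_map c z.1)}.
  exact: (continuous_comp fst_at (@center_map_continuous _ _ _ _ c lfK z.1)).
exact: (cvgZ (continuous_min (cvg_cst (1 : R))
  (cvgB (cvg_cst (2 : R)) (cvgM (cvg_cst (2 : R)) ct))) cF).
Qed.

Lemma contraction_weight_continuous v : continuous (contraction_weight^~ v).
Proof.
move=> z.
have fst_at : {for z, continuous (fst : X * R -> X)} by exact: cvg_fst.
have ct : {for z, continuous (fun z : X * R => z.2)} by exact: cvg_snd.
have cx : {for z, continuous (fun z : X * R => bary v z.1)}.
  exact: (continuous_comp fst_at (@bary_continuous _ _ _ v z.1)).
have cth : {for z, continuous (fun z : X * R => threshold z.1)}.
  exact: (continuous_comp fst_at (@threshold_continuous _ _ _ lfK z.1)).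
have cd : {for z, continuous (fun z : X * R => d1 (track z) (p v))}.
  exact: (continuous_comp (@track_continuous z)
    (@d1_continuous _ _ (p v) (track z))).
have cscale (a : R) : {for z, continuous (fun z : X * R => a * z.2)}.
  exact: (cvgM (cvg_cst a) ct).
have c1 : {for z, continuous (fun z : X * R => pos_part (1 - 2 * z.2))}.
  exact: (cvg_pos_part (cvgB (cvg_cst (1 : R)) (cscale 2))).
have c2 : {for z, continuous (fun z : X * R => pos_part (4 * z.2 - 1))}.
  exact: (cvg_pos_part (cvgB (cscale 4) (cvg_cst (1 : R)))).
have c3 : {for z, continuous (fun z : X * R =>
    pos_part (eps - d1 (track z) (p v)))}.
  exact: (cvg_pos_part (cvgB (cvg_cst eps) cd)).
have c4 : {for z, continuous (fun z : X * R =>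
    pos_part (bary v z.1 - pos_part (4 * z.2) * threshold z.1))}.
  exact: (cvg_pos_part (cvgB cx (cvgM (cvg_pos_part (cscale 4)) cth))).
exact: (cvgD (cvgM c1 c4) (cvgM c2 c3)).
Qed.

Lemma contraction_weight_locally_finite z :
  locally_finite_family z contraction_weight.
Proof.
have [W WE] := bary_locally_finite lfK z.1.
(* The track moves by less than 1 on a neighborhood of [z]. *)
pose ball := fset_set [set v | d1 (track z) (p v) < eps + 1].
exists (W `|` ball)%fset.
have near_W : \forall y \near z, forall v, v \notin W -> bary v y.1 = 0.
  by exact: (@cvg_fst _ _ _ _ (nbhs_filter z.2) _ WE).
have near_track : \forall y \near z, d1 (track y) (track z) < 1.
  have c0 : {for z, continuous (fun y => d1 (track y) (track z))}.
    exact: (continuous_comp (@track_continuous z)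
      (@d1_continuous _ _ (track z) (track z))).
  by apply: (cvgr_lt _ c0); rewrite d1xx ltr01.
apply: filterS2 near_W near_track => -[x t] xW xt v.
rewrite in_fsetU negb_or => /andP[/xW /= xv vball].
rewrite /contraction_weight /leaving_weight /entering_weight/= xv.
rewrite (@pos_part_neg _ (0 - _)); last first.
  by rewrite sub0r oppr_le0 mulr_ge0 ?pos_part_ge0// ltW// threshold_gt0.
rewrite mulr0 add0r (@pos_part_neg _ (eps - _)) ?mulr0// subr_le0 leNgt.
apply: contra vball => h.
rewrite in_fset_set ?inE//=.
apply: le_lt_trans (d1_triangle (track (x, t)) _ _) _.
by rewrite d1C addrC ltrD.
Qed.

Lemma contraction_continuous : continuous contraction.
Proof.
apply: normalize_continuous => //.
- exact: contraction_weight_continuous.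
- exact: contraction_weight_locally_finite.
Qed.

(** The vertices left over by the first stage, with those that represent the
    center map, form a simplex by [glue]; so do the vertices that represent a
    point of R^n. *)
Lemma contractible_by_centers : (exists s, simplex K s) ->
  contractible R X.
Proof.
move=> [s0 Ks0].
pose u0 (v : V) : R := (v \in s0)%:R.
have u0w : simplicial_weights K u0.
  split; first by move=> v; exact: ler0n.
  by exists s0 => // v; rewrite /u0 pnatr_eq0 eqb0 negbK.
exists (contraction (normalize u0w, 1)), contraction; split.
- by apply: continuous_subspaceT; exact: contraction_continuous.
- move=> x; apply: eq_bary => v; rewrite normalizeE.
  have uE w : contraction_weight (x, 0) w = bary w x.
    rewrite /contraction_weight /leaving_weight /entering_weight/=.
    rewrite !mulr0 (pos_part_neg (lexx 0)) mul0r !subr0.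
    rewrite (pos_part_id ler01) mul1r pos_part_id ?bary_ge0//.
    by rewrite pos_part_neg ?mul0r ?addr0// sub0r oppr_le0.
  under eq_fsbigr do rewrite uE.
  by rewrite uE bary_sum divr1.
- move=> x; apply: eq_bary => v; rewrite !normalizeE.
  (* At time 1 the leaving part is zero and the track is at the origin. *)
  suff -> : contraction_weight (x, 1) = contraction_weight (normalize u0w, 1) by [].
  apply/funext => w.
  rewrite /contraction_weight /leaving_weight /entering_weight /track/=.
  rewrite pos_part_neg ?mul0r; last by lra.
  by rewrite min_r ?mulr1 ?subrr ?scale0r ?ler01.
Qed.
End Contraction.

(** * The lattice *)

Lemma floor_close (R : realType) n (e : 'rV[R]_n) : (0 < n)%N ->
  exists v : 'rV[int]_n, d1 e (map_mx intr v) < n%:R.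
Proof.
move=> n0; exists (\row_j Num.floor (e ord0 j)).
have -> : n%:R = \sum_(j < n) (1 : R) by rewrite sumr_const card_ord.
rewrite /d1; apply: ltr_sum => [|j _].
  by apply/hasP; exists (Ordinal n0) => //; rewrite mem_index_enum.
rewrite !mxE ger0_norm ?subr_ge0 ?floor_le_tmp//.
by rewrite ltrBlDl -intrD1 floorD1_gt.
Qed.

Lemma finite_lattice_ball (R : realType) n (e : 'rV[R]_n) (M : R) :
  finite_set [set v : 'rV[int]_n | d1 e (map_mx intr v) < M].
Proof.
pose N := Num.bound `|M|.
have MN : M < N%:R.
  exact: le_lt_trans (ler_norm M) (archi_boundP (normr_ge0 M)).
(* The coordinates of the lattice points of the ball, counted from [N] below
   the floor of those of [e], are less than [2 * N + 2]. *)
pose corner (f : {ffun 'I_n -> 'I_(N.*2.+2)}) : 'rV[int]_n :=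
  \row_j (Num.floor (e ord0 j) - N%:Z + (f j)%:Z).
apply: (@sub_finite_set _ _ (corner @` [set: {ffun _}])); last first.
  by apply: finite_image; exact: finite_finset.
move=> v /= dv; pose f j := `|(v ord0 j - Num.floor (e ord0 j) + N%:Z)%R|%N.
exists [ffun j => inord (f j)] => //; apply/rowP => j; rewrite !mxE ffunE.
have : `|e ord0 j - (v ord0 j)%:~R| < N%:R.
  apply: le_lt_trans (lt_trans dv MN); rewrite /d1 (bigD1 j)//= mxE lerDl.
  by apply: sumr_ge0.
rewrite ltr_norml => /andP[lo hi].
have /andP[fl fu] := floor_itv (e ord0 j).
have ge0 : 0 <= v ord0 j - Num.floor (e ord0 j) + N%:Z.
  rewrite -(ler_int R) !(rmorphD, rmorphN)/=; lra.
have lt : v ord0 j - Num.floor (e ord0 j) + N%:Z < (N.*2.+2)%:Z.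
  rewrite -(ltr_int R) -addn2 -addnn !PoszD !(rmorphD, rmorphN)/=.
  by move: fu; rewrite rmorphD/=; lra.
by rewrite inordK /f -?[v 0 j]/(v ord0 j); lia.
Qed.

Lemma d1_lattice_int (R : realType) n (a b : 'rV[int]_n) :
  d1 (map_mx intr a) (map_mx intr b) =
  (\sum_(i < n) `|a ord0 i - b ord0 i|)%:~R :> R.
Proof.
rewrite rmorph_sum/=; apply: eq_bigr => i _.
by rewrite !mxE -intrB intr_norm.
Qed.

Theorem theorem5p1 (R : realType) (n : nat) (r : R) :
  (0 < n)%N -> n%:R ^+ 2 * (2 * n%:R - 1) <= r ->
  contractible R (realization R (rips (lattice_d1 R n) r)).
Proof.
move=> n0 nr.
have n1 : 1 <= n%:R :> R by rewrite ler1n.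
pose L := lattice_d1 R n.
pose p (v : L) : 'rV[R]_n := map_mx intr v.
(* Distances are integers: only the integer part of the scale matters. *)
pose m : R := (Num.floor r)%:~R.
have mr : m <= r := floor_le r.
have nm : n%:R ^+ 2 * (2 * n%:R - 1) <= m.
  have E : n%:R ^+ 2 * (2 * n%:R - 1) = (n%:Z ^+ 2 * (2 * n%:Z - 1))%:~R :> R.
    by rewrite !(rmorphM, rmorphB, rmorphXn).
  by rewrite E ler_int floor_ge_int -E.
have n2m : 2 * n%:R <= m + 1.
  suff : 2 * n%:R - 1 <= m by lra.
  apply: le_trans nm; apply: ler_peMl; first lra.
  exact: exprn_ege1.
have n22m : n%:R ^+ 2 <= m.
  apply: le_trans nm; apply: ler_peMr; [exact: sqr_ge0|lra].
have m0 : 0 <= m by apply: le_trans n22m; exact: sqr_ge0.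
have r0 : 0 <= r := le_trans m0 mr.
pose rho : R := n%:R / n.+1%:R * m.
have rho_le : rho + n%:R <= m + 1.
  have -> : rho = m - m / n.+1%:R.
    rewrite /rho -natr1; field.
    by rewrite natr1 pnatr_eq0.
  have : n%:R - 1 <= m / n.+1%:R.
    rewrite ler_pdivlMr ?ltr0Sn// -natr1; lra.
  set q := m / _; lra.
have mdistE (a b : L) : mdist a b = d1 (p a) (p b) by [].
have dist_int (a b : L) : d1 (p a) (p b) < m + 1 -> mdist a b <= m.
  rewrite mdistE d1_lattice_int -intrD1 ltr_int ler_int.
  by rewrite ltzD1.
have dist_floor (a b : L) : mdist a b <= r -> d1 (p a) (p b) <= m.
  by rewrite mdistE d1_lattice_int ler_int -floor_ge_int.
have ripsP (s : {fset L}) : simplex (rips L r) s <->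
    s != fset0 /\ forall a b, a \in s -> b \in s -> mdist a b <= r.
  by split=> -[s0 H]; split => //; exact/(diamP s r0).
have fin_ball (e : 'rV[R]_n) M : finite_set [set v : L | d1 e (p v) < M].
  exact: finite_lattice_ball.
have lf : locally_finite (rips L r).
  move=> v; pose B := fset_set [set w : L | d1 (p v) (p w) < r + 1].
  apply: (@sub_finite_set _ _ [set` fpowerset B]); last exact: finite_fset.
  move=> s [/ripsP[_ sr] vs] /=; rewrite fpowersetE; apply/fsubsetP => w ws.
  rewrite in_fset_set ?inE//= -mdistE.
  by apply: le_lt_trans (sr _ _ vs ws) _; rewrite ltrDl.
have centers (s : {fset L}) : exists c : 'rV[R]_n,
    simplex (rips L r) s -> forall v, v \in s -> d1 c (p v) <= rho.
  have [/ripsP[_ sr]|] := pselect (simplex (rips L r) s); last by exists 0.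
  have [i j|c cP] := @jung_center R n _ (fun i => p (tnth (in_tuple s) i)) m.
    by apply: dist_floor; apply: sr; exact: mem_tnth.
  exists c => _ v vs; have /tnthP[i ->] : v \in in_tuple s by [].
  exact: cP.
have [c cP] := choice centers.
apply: (@contractible_by_centers _ _ _ _ p n%:R rho _ _ _ _ c) => //.
- by move=> e; exact: floor_close.
- move=> e s t /ripsP[_ sr] t0 tP; apply/ripsP; split => // a b ta tb.
  have close x y : d1 e (p x) <= rho -> d1 e (p y) < n%:R -> mdist x y <= r.
    move=> xr yn; apply: le_trans mr; apply: dist_int.
    by apply: le_lt_trans (d1_triangle e _ _) _; rewrite d1C; lra.
  case: (tP a ta) (tP b tb) => [[sa ea]|ea] [[sb eb]|eb].
  + exact: sr.
  + exact: close.
  + by rewrite metric_sym; exact: close.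
  + apply: le_trans mr; apply: dist_int.
    by apply: le_lt_trans (d1_triangle e _ _) _; rewrite d1C; lra.
- by exists [fset (0 : 'rV[int]_n)]%fset; exact: rips_vertex.
Qed.
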